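(* Let $G$ be a cyclic group of odd order $n$. Then the number of biantiautomorphisms of $G$ is $$\prod_{p \in \mathbf{P}_{n}} p^{\alpha_p-1}(p-2),$$ where $\mathbf{P}_{n}$ is the set of prime divisors of $n$ and, for each $p \in \mathbf{P}_n$, $\alpha_p$ is the greatest integer such that $p^{\alpha_p}$ divides $n$.
   Context: Let $G$ be a finite abelian group (written additively). A function $f: G \rightarrow G$ is an antimorphism if the map $\mathrm{id}_{G}-f$, $x \mapsto x-f(x)$, is injective. An antiautomorphism of $G$ is an antimorphism $f: G\to G$ that is a bijection. A biantiautomorphism of $G$ is an antiautomorphism of $G$ that is also a linear map, i.e. $\mathbf{Z}$-linear (a group homomorphism). *)

(* Defs.v *)
From mathcomp Require Import all_boot all_order all_fingroup all_algebra.
From mathcomp Require Import all_solvable.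
From mathcomp Require Import boolp.

Set Implicit Arguments.
Unset Strict Implicit.
Unset Printing Implicit Defensive.

Local Open Scope ring_scope.

Definition antimorphism (G : finZmodType) (f : G -> G) : Prop :=
  injective (fun x : G => x - f x).

Definition antiautomorphism (G : finZmodType) (f : G -> G) : Prop :=
  antimorphism f /\ bijective f.

Definition biantiautomorphism (G : finZmodType) (f : G -> G) : Prop :=
  antiautomorphism f /\ GRing.zmod_morphism f.

(* Main.v *)
Require Import Defs.
From mathcomp Require Import all_boot all_order all_fingroup all_algebra.
From mathcomp Require Import all_solvable.
From mathcomp Require Import boolp.

Import GRing.Theory FinRing.Theory.

(** Fix a generator [g] of the cyclic group [G] of order [n].  An endomorphism
    is determined by the image of [g], so it is multiplication by an integer
    that is unique modulo [n].  Write this integer as [k + 1]: the map is then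
    [x |-> (k + 1) x] and [id - f] is [x |-> - k x].  Multiplication by [m] is
    injective on [G] exactly when [m] is coprime to [n] (lemma
    [mulrn_injE]), so the biantiautomorphisms correspond to the residues [k]
    such that both [k] and [k + 1] are units modulo [n]
    ([card_biantiautomorphism]).

    The number [count_consecutive n] of such residues is computed like the
    Euler totient.  It is multiplicative by the Chinese remainder theorem
    ([count_consecutiveM]), so it suffices to treat a prime power [p ^ e.+1].
    There the condition depends only on [k] modulo [p], and it excludes
    exactly the two classes 0 and [p - 1]; each of the remaining [p - 2]
    classes has [p ^ e] representatives ([count_consecutive_pfactor]). *)

(** * Counting pairs of consecutive units modulo n *)

Definition consecutive_coprime (n k : nat) : bool :=
  coprime n k && coprime n k.+1.

Definition count_consecutive (n : nat) : nat :=
  \sum_(k < n) consecutive_coprime n k.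

Lemma consecutive_coprime_mod (n k : nat) :
  consecutive_coprime n (k %% n) = consecutive_coprime n k.
Proof.
rewrite /consecutive_coprime coprime_modr; congr andb.
by rewrite -[LHS]coprime_modr -addn1 modnDml addn1 coprime_modr.
Qed.

Lemma consecutive_coprimeMl (a b k : nat) :
  consecutive_coprime (a * b) k =
    consecutive_coprime a k && consecutive_coprime b k.
Proof. by rewrite /consecutive_coprime !coprimeMl andbACA. Qed.

(** The Chinese remainder theorem identifies residues modulo [a * b] with
    pairs of residues, and the condition modulo [a * b] is the conjunction of
    the conditions on the two components. *)
Lemma count_consecutiveM (a b : nat) : coprime a b ->
  count_consecutive (a * b) = count_consecutive a * count_consecutive b.
Proof.
move=> co_ab.
have [->|a_gt0] := posnP a; first by rewrite /count_consecutive !big_ord0.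
have [->|b_gt0] := posnP b; first by rewrite muln0 /count_consecutive !big_ord0 muln0.
pose h (k : 'I_(a * b)) : 'I_a * 'I_b :=
  (Ordinal (ltn_pmod k a_gt0), Ordinal (ltn_pmod k b_gt0)).
have h_bij : bijective h.
  apply: inj_card_bij => [k l [] eq_a eq_b|]; last by rewrite card_prod !card_ord.
  apply/val_inj/eqP; rewrite /= -(modn_small (ltn_ord k)) -(modn_small (ltn_ord l)).
  by rewrite chinese_remainder // eq_a eq_b !eqxx.
rewrite /count_consecutive big_distrlr /= pair_bigA /= (reindex h) /=; last exact: onW_bij.
apply: eq_bigr => k _.
by rewrite !consecutive_coprime_mod consecutive_coprimeMl mulnb.
Qed.

(** Multiplicativity is applied along the list of distinct primes, whose
    powers are pairwise coprime. *)
Lemma count_consecutive_prod (n : nat) : 0 < n ->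
  count_consecutive n = \prod_(p <- primes n) count_consecutive (p ^ logn p n).
Proof.
move=> n_gt0; rewrite [in LHS](prod_prime_decomp n_gt0) prime_decompE big_map /=.
have: all prime (primes n) by apply/allP => p; rewrite mem_primes => /and3P[].
elim: (primes n) (primes_uniq n) => [_ _|p s IHs /= /andP[ps us] /andP[p_pr s_pr]].
  by rewrite !big_nil /count_consecutive big_ord_recl big_ord0.
rewrite !big_cons count_consecutiveM ?IHs // coprimeXl // big_seq.
apply: (big_ind (coprime p)) => [|x y cx cy|q qs]; first exact: coprimen1.
  by rewrite coprimeMr cx.
rewrite coprimeXr // prime_coprime // dvdn_prime2 ?(allP s_pr q qs) //.
by apply: contraNneq ps => ->.
Qed.

Lemma sum_periodic (m p : nat) (F : nat -> nat) : (forall k, F (p + k) = F k) ->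
  \sum_(k < m * p) F k = m * \sum_(k < p) F k.
Proof.
move=> perF; elim: m => [|m IHm]; first by rewrite big_ord0.
rewrite !mulSn big_split_ord /= -IHm.
by congr addn; apply: eq_bigr => k _; rewrite perF.
Qed.

(** Modulo [p] only the residues [0] and [p - 1] fail, and they are distinct
    since [p >= 2]. *)
Lemma count_consecutive_prime (p : nat) : prime p -> count_consecutive p = p - 2.
Proof.
move=> p_pr; have := prime_gt1 p_pr; case: p p_pr => [|[|q]] // p_pr _.
rewrite /count_consecutive big_ord_recl big_ord_recr /=.
rewrite /consecutive_coprime /bump !prime_coprime //= !add1n dvdnn andbF addn0 subn2.
rewrite add0n (eq_bigr (fun=> 1)) ?sum1_card ?card_ord // => i _.
by rewrite !prime_coprime // !gtnNdvd //= !ltnS // ltnW.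
Qed.

Lemma count_consecutive_pfactor (p e : nat) : prime p ->
  count_consecutive (p ^ e.+1) = p ^ e * (p - 2).
Proof.
move=> p_pr; rewrite -count_consecutive_prime // /count_consecutive.
rewrite -(@sum_periodic _ _ (fun k => consecutive_coprime p k : nat)) -?expnSr.
  by apply: eq_bigr => k _; rewrite /consecutive_coprime !coprime_pexpl.
by move=> k; rewrite -consecutive_coprime_mod modnDl consecutive_coprime_mod.
Qed.

Lemma count_consecutiveE (n : nat) : 0 < n ->
  count_consecutive n = \prod_(p <- primes n) (p ^ (logn p n - 1) * (p - 2)).
Proof.
move=> n_gt0; rewrite count_consecutive_prod // !big_seq.
apply: eq_bigr => p p_n; have p_pr: prime p by move: p_n; rewrite mem_primes => /and3P[].
move: p_n; rewrite -logn_gt0; case: (logn p n) => // e _.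
by rewrite count_consecutive_pfactor // subn1.
Qed.

(** * Endomorphisms of a cyclic group *)

Lemma cyclic_generator (G : finZmodType) : cyclic [set: G] ->
  exists g : G, (forall x : G, exists k : 'I_#|G|, x = (g *+ k)%R) /\
    (forall i j : nat, ((g *+ i)%R == (g *+ j)%R) = (i == j %[mod #|G|])).
Proof.
case/cyclicP => g defG; have ordg : #[g]%g = #|G| by rewrite orderE -defG cardsT.
exists g; split=> [x|i j]; last by rewrite -!zmodXgE eq_expg_mod_order ordg.
have /cyclePmin[k lt_k ->] : x \in <[g]>%g by rewrite -defG inE.
by rewrite ordg in lt_k; exists (Ordinal lt_k); rewrite zmodXgE.
Qed.

(** If [d = gcdn n m] exceeds 1, then [n / d] is a nonzero residue killed by
    [m]; conversely a factor coprime to [n] cancels modulo [n]. *)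
Lemma mulrn_injE (G : finZmodType) (m : nat) : cyclic [set: G] ->
  injective (fun x : G => x *+ m)%R <-> coprime #|G| m.
Proof.
case/cyclic_generator => g [genG eqG].
have n_gt0 : 0 < #|G| by apply/card_gt0P; exists g.
split=> [inj_m | co_m x y].
  have [q def_n] := dvdnP (dvdn_gcdl #|G| m).
  have q_gt0 : 0 < q by move: n_gt0; rewrite def_n muln_gt0 => /andP[].
  have kill_q : #|G| %| q * m by rewrite {1}def_n dvdn_pmul2l ?dvdn_gcdr.
  have : (g *+ q)%R = (g *+ 0)%R.
    by apply: inj_m; apply/eqP; rewrite -!mulrnA eqG mul0n mod0n.
  move/eqP; rewrite eqG mod0n => n_dvd_q.
  by rewrite /coprime -dvdn1 -(dvdn_pmul2l q_gt0) muln1 -def_n.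
have [i ->] := genG x; have [j ->] := genG y => /eqP.
rewrite -!mulrnA eqG => eq_ij; apply/eqP; rewrite eqG.
wlog le_ij : i j eq_ij / j <= i.
  by move=> W; case/orP: (leq_total i j) => ?; [rewrite eq_sym|]; apply: W => //; rewrite eq_sym.
by move: eq_ij; rewrite !eqn_mod_dvd ?leq_mul // -mulnBl Gauss_dvdl.
Qed.

(** Indexing by [k.+1] makes [id - f] multiplication by [- k], so that both
    conditions are coprimality conditions on natural numbers without
    truncated subtraction. *)
Definition mulrS_ffun (G : finZmodType) (k : nat) : {ffun G -> G} :=
  [ffun x => (x *+ k.+1)%R].

Lemma biantiautomorphism_mulrS (G : finZmodType) (k : nat) : cyclic [set: G] ->
  biantiautomorphism (mulrS_ffun G k) <-> consecutive_coprime #|G| k.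
Proof.
move=> cycG.
have subE x : (x - mulrS_ffun G k x = - (x *+ k))%R.
  by rewrite ffunE mulrS opprD addrA subrr add0r.
split=> [[[anti /bij_inj inj_f] _] | /andP[/(mulrn_injE _ _ cycG) inj_k /(mulrn_injE _ _ cycG) inj_kS]].
  apply/andP; split; apply/(mulrn_injE _ _ cycG) => x y eq_xy.
    by apply: anti; rewrite !subE eq_xy.
  by apply: inj_f; rewrite !ffunE.
split; first split.
- by move=> x y; rewrite !subE => /oppr_inj/inj_k.
- by apply: injF_bij => x y; rewrite !ffunE => /inj_kS.
- by move=> x y; rewrite !ffunE mulrnBl.
Qed.

Lemma additive_mulrS (G : finZmodType) (f : {ffun G -> G}) : cyclic [set: G] ->
  GRing.zmod_morphism f -> exists k : 'I_#|G|, f = mulrS_ffun G k.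
Proof.
case/cyclic_generator => g [genG eqG] morph_f.
have f0 : f 0%R = 0%R by have := morph_f 0%R 0%R; rewrite !subrr.
have fN x : f (- x)%R = (- f x)%R by rewrite -sub0r morph_f f0 sub0r.
have fD x y : f (x + y)%R = (f x + f y)%R.
  by rewrite -{1}(opprK y) morph_f fN opprK.
have fMn x i : f (x *+ i)%R = (f x *+ i)%R.
  by elim: i => [|i IHi]; rewrite ?mulr0n // !mulrS fD IHi.
(* The predecessor is taken in the group, where [f g - g] exists even when
   [f g = 0]. *)
have [k def_k] := genG (f g - g)%R; exists k; apply/ffunP => x.
rewrite ffunE; have [i ->] := genG x.
by rewrite fMn -mulrnA mulnC mulrnA mulrS -def_k addrC subrK.
Qed.

Lemma card_biantiautomorphism (G : finZmodType) : cyclic [set: G] ->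
  #|[set f : {ffun G -> G} | `[< biantiautomorphism f >]]|
    = count_consecutive #|G|.
Proof.
move=> cycG.
have -> : [set f : {ffun G -> G} | `[< biantiautomorphism f >]] =
    [set mulrS_ffun G k | k : 'I_#|G| & consecutive_coprime #|G| k].
  apply/setP => f; rewrite inE; apply/asboolP/imsetP => [bi_f|[k]].
    have [k def_f] := additive_mulrS _ _ cycG (proj2 bi_f).
    by exists k => //; rewrite inE; apply/biantiautomorphism_mulrS; rewrite -?def_f.
  by rewrite inE => co_k ->; apply/biantiautomorphism_mulrS.
rewrite card_imset => [|k l /ffunP eq_kl].
  by rewrite /count_consecutive -big_mkcond sum1dep_card.
have [g [_ eqG]] := cyclic_generator _ cycG.
move/eqP: (eq_kl g); rewrite !ffunE eqG -[k.+1]addn1 -[l.+1]addn1 eqn_modDr.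
by rewrite !modn_small // => /eqP/val_inj.
Qed.

Theorem theorem3p5 (G : finZmodType) (n : nat) (cyclicG : cyclic [set: G])
    (cardG : #|G| = n) (oddn : odd n) :
  #|[set f : {ffun G -> G} | `[< biantiautomorphism f >]]|
    = (\prod_(p <- primes n) (p ^ (logn p n - 1) * (p - 2)))%N.
Proof.
rewrite card_biantiautomorphism // cardG count_consecutiveE //.
exact: odd_gt0.
Qed.
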